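(* Let $d\ge 1$ and let $(X_N)_{N\in\mathbb{N}}$ be a sequence of point sets $X_N\subset\mathbb{S}^d$ with $\#X_N=N$, which is hyperuniform for caps at threshold order. Then $(X_N)_{N\in\mathbb{N}}$ is (asymptotically) uniformly distributed on $\mathbb{S}^d$.
   Context: $\mathbb{S}^d\subset\mathbb{R}^{d+1}$ is the unit sphere, $\langle\cdot,\cdot\rangle$ the Euclidean inner product, and $\sigma$ the normalised ($\sigma(\mathbb{S}^d)=1$) surface area measure on $\mathbb{S}^d$. For $\mathbf{x}\in\mathbb{S}^d$ and $\phi\in[0,\pi]$, the spherical cap is $C(\mathbf{x},\phi)=\{\mathbf{y}\in\mathbb{S}^d : \langle\mathbf{x},\mathbf{y}\rangle>\cos\phi\}$; its measure $\sigma(C(\cdot,\phi))$ does not depend on the centre. Number variance: for an $N$-point set $X_N\subset\mathbb{S}^d$, $$V(X_N,\phi)=\int_{\mathbb{S}^d}\bigl(\#(X_N\cap C(\mathbf{x},\phi))-N\sigma(C(\cdot,\phi))\bigr)^2\,\mathrm{d}\sigma(\mathbf{x}).$$ Hyperuniform for caps at threshold order: $\limsup_{N\to\infty}V(X_N,tN^{-1/d})=\mathcal{O}(t^{d-1})$ as $t\to\infty$ (for each fixed $t>0$ the limsup only involves $N$ large enough that $tN^{-1/d}\le\pi$). (Asymptotically) uniformly distributed on $\mathbb{S}^d$: for all $\mathbf{x}\in\mathbb{S}^d$ and $\phi\in[0,\pi]$, $\lim_{N\to\infty}\frac1N\#(X_N\cap C(\mathbf{x},\phi))=\sigma(C(\mathbf{x},\phi))$.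 *)

(* Defs.v *)
From HB Require Import structures.
From mathcomp Require Import all_boot all_order all_algebra.
From mathcomp Require Import finmap.
From mathcomp Require Import all_classical all_reals all_analysis.
From mathcomp Require Import measurable_realfun.

Set Implicit Arguments.
Unset Strict Implicit.
Unset Printing Implicit Defensive.

Import Order.TTheory GRing.Theory Num.Theory.
Import numFieldNormedType.Exports.

Local Open Scope classical_set_scope.
Local Open Scope ring_scope.

Lemma sigma_finite_prod d1 d2 (T1 : measurableType d1) (T2 : measurableType d2)
    (R : realType) (m1 : {sigma_finite_measure set T1 -> \bar R})
    (m2 : {sigma_finite_measure set T2 -> \bar R}) :
  sigma_finite setT (m1 \x m2)%E.
Proof.
have /sigma_finiteP[F [TF ndF Foo]] := sigma_finiteT m1.
have /sigma_finiteP[G [TG ndG Goo]] := sigma_finiteT m2.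
exists (fun n => F n `*` G n).
  rewrite -setXTT TF TG predeqE => -[x y]; split.
    move=> [/= [n _ Fnx] [k _ Gky]]; exists (maxn n k) => //; split.
    - by move: x Fnx; exact/subsetPset/ndF/leq_maxl.
    - by move: y Gky; exact/subsetPset/ndG/leq_maxr.
  by move=> [n _ []/= ? ?]; split; exists n.
move=> k; have [? ?] := Foo k; have [? ?] := Goo k.
split; first exact: measurableX.
by rewrite product_measure1E// lte_mul_pinfty// ge0_fin_numE.
Qed.

Section lebesgue_tuple.
Variable R : realType.

(* [lebesgue_measure] lives on the alias [measurableTypeR R] of [R], hence the
   type of the first component. *)
Definition tuple_cons n (p : measurableTypeR R * n.-tuple R) : n.+1.-tuple R :=
  [tuple of (p.1 : R) :: p.2].

Definition tuple_uncons n (x : n.+1.-tuple R) : measurableTypeR R * n.-tuple R :=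
  (thead x, [tuple of behead x]).

Lemma tuple_consK n : cancel (@tuple_cons n) (@tuple_uncons n).
Proof. by case=> a x; congr pair; apply: val_inj. Qed.

Lemma measurable_tuple_cons n : measurable_fun setT (@tuple_cons n).
Proof.
apply: (@measurable_cons _ _ _ R (fun p => p.1 : R) n snd) => //.
exact: (@measurable_fst _ _ (measurableTypeR R) (n.-tuple R)).
Qed.

Lemma measurable_tuple_uncons n : measurable_fun setT (@tuple_uncons n).
Proof.
apply/measurable_fun_pairP; split; last exact: measurable_behead.
exact: (@measurable_tnth _ R n.+1 ord0).
Qed.

Section step.
Local Open Scope ereal_scope.
Variables (n : nat) (m : {sigma_finite_measure set (n.-tuple R) -> \bar R}).

Definition lebesgue_step : set (n.+1.-tuple R) -> \bar R :=
  pushforward (lebesgue_measure \x m) (@tuple_cons n).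

Let step0 : lebesgue_step set0 = 0.
Proof. by rewrite /lebesgue_step /pushforward preimage_set0 measure0. Qed.

Let step_ge0 A : 0 <= lebesgue_step A.
Proof. by rewrite /lebesgue_step /pushforward; exact: measure_ge0. Qed.

Let step_sigma_additive : semi_sigma_additive lebesgue_step.
Proof.
move=> F mF tF mUF; rewrite /lebesgue_step /pushforward preimage_bigcup.
have mc A : measurable A -> measurable (@tuple_cons n @^-1` A).
  by move=> mA; rewrite -[X in measurable X]setTI; exact: measurable_tuple_cons.
apply: measure_semi_sigma_additive.
- by move=> k; exact: mc.
- apply/trivIsetP => /= i j _ _ ij; rewrite -preimage_setI.
  by move/trivIsetP : tF => /(_ _ _ _ _ ij) ->//; rewrite preimage_set0.
- by rewrite -preimage_bigcup; exact: mc.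
Qed.

HB.instance Definition _ := isMeasure.Build _ _ _ lebesgue_step
  step0 step_ge0 step_sigma_additive.

Let step_sigma_finite : sigma_finite setT lebesgue_step.
Proof.
have [F TF Foo] := sigma_finite_prod (@lebesgue_measure R) m.
exists (fun i => @tuple_uncons n @^-1` F i).
  by rewrite -preimage_bigcup -TF preimage_setT.
move=> i; have [mF Fi] := Foo i; split.
  by rewrite -[X in measurable X]setTI; exact: measurable_tuple_uncons.
rewrite /lebesgue_step /pushforward -comp_preimage.
suff -> : @tuple_uncons n \o @tuple_cons n = id by [].
by apply/funext => p; exact: tuple_consK.
Qed.

HB.instance Definition _ := Measure_isSigmaFinite.Build _ _ _ lebesgue_step
  step_sigma_finite.

End step.

Fixpoint lebesgue_tuple n : {sigma_finite_measure set (n.-tuple R) -> \bar R} :=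
  if n is k.+1 then lebesgue_step (lebesgue_tuple k) else \d_[tuple].


Lemma measurable_cube n (D : set R) : measurable D ->
  measurable [set x : n.-tuple R | forall i, D (tnth x i)].
Proof.
move=> mD.
rewrite (_ : [set x | _] =
    \bigcap_(i in [set: 'I_n]) ((@tnth n R)^~ i @^-1` D)); last first.
  by apply/seteqP; split=> x /= xD i => [_|]; exact: xD.
apply: fin_bigcap_measurable => // i _; rewrite -[X in measurable X]setTI.
exact: measurable_tnth.
Qed.

Lemma lebesgue_tuple_cube n (D : set R) : measurable D ->
  lebesgue_tuple n [set x | forall i, D (tnth x i)] =
    (lebesgue_measure D ^+ n)%E.
Proof.
move=> mD; elim: n => [|n IHn].
  by rewrite /= diracE mem_set// => -[].
rewrite expeS /= /lebesgue_step /pushforward.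
rewrite (_ : _ @^-1` _ = (D : set (measurableTypeR R)) `*`
    [set x : n.-tuple R | forall i, D (tnth x i)]).
  rewrite product_measure1E//; last exact: measurable_cube.
  by rewrite IHn.
apply/seteqP; split=> -[a x] /= => [xD|[Da xD] i].
  split; first by have := xD ord0; rewrite tnth0.
  by move=> i; have := xD (lift ord0 i); rewrite tnthS.
by case: (unliftP ord0 i) => [j ->|->]; rewrite ?tnthS ?tnth0//; exact: xD.
Qed.

End lebesgue_tuple.

Lemma measurable_inv (R : realType) : measurable_fun [set: R] (@GRing.inv R).
Proof.
rewrite -[X in measurable_fun X _](setvU [set 0]).
have m0 : measurable [set 0 : R] by [].
apply/measurable_funU => //; first exact: measurableC.
split; last exact: measurable_fun_set1.
apply: open_continuous_measurable_fun.
  by rewrite openC; exact/accessible_closed_set1/hausdorff_accessible/Rhausdorff.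
by move=> x; rewrite inE/= => /eqP x0; exact: inv_continuous.
Qed.

Section euclidean.
Variables (R : realType) (n : nat).
Implicit Types (x y : n.-tuple R) (A : set (n.-tuple R)).

Definition dotp x y : R := \sum_(i < n) tnth x i * tnth y i.

Definition enorm x : R := Num.sqrt (dotp x x).

Definition unit_sphere : set (n.-tuple R) := [set x | enorm x = 1].

Definition punctured_ball : set (n.-tuple R) := [set x | 0 < enorm x <= 1].

Definition radial_proj x : n.-tuple R := [tuple tnth x i / enorm x | i < n].

Lemma measurable_dotp : measurable_fun setT (fun x => dotp x x).
Proof.
rewrite /dotp; apply: measurable_sum => i.
by apply: measurable_funM; exact: measurable_tnth.
Qed.

Lemma measurable_enorm : measurable_fun setT enorm.
Proof.
apply: (measurableT_comp _ measurable_dotp).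
by apply: continuous_measurable_fun; exact: sqrt_continuous.
Qed.

Lemma measurable_punctured_ball : measurable punctured_ball.
Proof.
rewrite (_ : punctured_ball = enorm @^-1` `]0, 1]).
  by rewrite -[X in measurable X]setTI; exact: measurable_enorm.
by apply/seteqP; split=> x /=; rewrite in_itv.
Qed.

Lemma measurable_radial_proj : measurable_fun setT radial_proj.
Proof.
apply/measurable_fun_tnthP => i.
rewrite (_ : _ \o _ = fun x => tnth x i * (enorm x)^-1); last first.
  by apply/funext => x /=; rewrite tnth_mktuple.
apply: measurable_funM; first exact: measurable_tnth.
exact: measurableT_comp (@measurable_inv R) measurable_enorm.
Qed.

End euclidean.

Section punctured_ball_measure.
Variables (R : realType) (n : nat).
Local Notation lambda := (lebesgue_tuple R n.+1).
Local Notation B := (@punctured_ball R n.+1).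

Lemma punctured_ball_gt0 : (0 < lambda B)%E.
Proof.
pose a : R := n.+1%:R^-1.
have a0 : 0 < a by rewrite invr_gt0 ltr0n.
have a1 : a <= 1 by rewrite invf_le1 ?ltr0n// ler1n.
pose D : set R := `]0, a]%classic.
have mD : measurable D by exact: measurable_itv.
apply: (@lt_le_trans _ _ (lambda [set x | forall i, D (tnth x i)])).
  rewrite lebesgue_tuple_cube// expe_gt0// /D lebesgue_measure_itv/= lte_fin a0.
  by rewrite -?EFinB lte_fin subr0.
apply: le_measure; rewrite ?inE; [exact: measurable_cube|
  exact: measurable_punctured_ball|].
move=> x /= xD; rewrite /punctured_ball /= /enorm.
have x0 i : 0 < tnth x i <= a by have := xD i; rewrite /D /= in_itv.
rewrite sqrtr_gt0; apply/andP; split.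
  rewrite /dotp (bigD1 ord0)//= ltr_pwDl//.
    by case/andP: (x0 ord0) => h _; exact: mulr_gt0.
  by apply: sumr_ge0 => i _; rewrite -expr2 sqr_ge0.
rewrite -[leRHS]sqrtr1 ler_sqrt//.
apply: (@le_trans _ _ (\sum_(i < n.+1) a)).
  apply: ler_sum => i _; case/andP: (x0 i) => h1 h2.
  rewrite -[leRHS]mulr1; apply: ler_pM => //; try exact: ltW.
  exact: le_trans a1.
by rewrite sumr_const card_ord -(mulr_natr a) mulVf// pnatr_eq0.
Qed.

Lemma punctured_ball_fin : (lambda B < +oo)%E.
Proof.
pose D : set R := `[-1, 1]%classic.
have mD : measurable D by exact: measurable_itv.
apply: (@le_lt_trans _ _ (lambda [set x | forall i, D (tnth x i)])).
  apply: le_measure; rewrite ?inE; [exact: measurable_punctured_ball|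
    exact: measurable_cube|].
  move=> x /andP[_ x1] i; rewrite /D /= in_itv/= -ler_norml.
  rewrite -sqrtr_sqr (le_trans _ x1)// /enorm ler_wsqrtr//.
  rewrite /dotp (bigD1 i)//= -expr2 lerDl.
  by apply: sumr_ge0 => j _; rewrite -expr2 sqr_ge0.
rewrite lebesgue_tuple_cube// /D lebesgue_measure_itv.
by case: ifPn => _; rewrite -?EFinB -EFin_expe ltry.
Qed.

End punctured_ball_measure.

Section sphere_measure.
Local Open Scope ereal_scope.
Variables (R : realType) (d : nat).
Local Notation lambda := (lebesgue_tuple R d.+1).
Local Notation B := (@punctured_ball R d.+1).

(* The normalised surface measure, as the cone measure: the relative volume in
   the unit ball of the cone over [A]. It is a Borel measure on the ambient space
   R^(d+1), concentrated on the sphere. *)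
Definition sphere_measure (A : set (d.+1.-tuple R)) : \bar R :=
  ((fine (lambda B))^-1)%:E * lambda (@radial_proj R d.+1 @^-1` A `&` B).

Let mpre A : measurable A -> measurable (@radial_proj R d.+1 @^-1` A `&` B).
Proof.
move=> mA; apply: measurableI; last exact: measurable_punctured_ball.
by rewrite -[X in measurable X]setTI; exact: measurable_radial_proj.
Qed.

Let sphere0 : sphere_measure set0 = 0.
Proof. by rewrite /sphere_measure preimage_set0 set0I measure0 mule0. Qed.

Let sphere_ge0 A : 0 <= sphere_measure A.
Proof. by rewrite mule_ge0// lee_fin invr_ge0 fine_ge0. Qed.

Let sphere_sigma_additive : semi_sigma_additive sphere_measure.
Proof.
move=> F mF tF mUF; rewrite /sphere_measure preimage_bigcup setI_bigcupl.
have tF' : trivIset setT (fun i => @radial_proj R d.+1 @^-1` F i `&` B).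
  apply/trivIsetP => /= i j _ _ ij; rewrite setIACA -preimage_setI.
  by move/trivIsetP : tF => /(_ _ _ _ _ ij) ->//; rewrite preimage_set0 set0I.
rewrite [X in X @ _](_ : _ = fun k => ((fine (lambda B))^-1)%:E *
    \sum_(0 <= i < k) lambda (@radial_proj R d.+1 @^-1` F i `&` B)).
  apply: cvgeZl => //.
  apply: measure_semi_sigma_additive => //; first by move=> i; exact: mpre.
  by apply: bigcupT_measurable => i; exact: mpre.
by apply/funext => k; rewrite ge0_sume_distrr.
Qed.

HB.instance Definition _ := isMeasure.Build _ _ _ sphere_measure
  sphere0 sphere_ge0 sphere_sigma_additive.

Let sphereT : sphere_measure setT = 1.
Proof.
have B0 := @punctured_ball_gt0 R d; have Boo := @punctured_ball_fin R d.
have Bfin : lambda B \is a fin_num by rewrite ge0_fin_numE.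
rewrite /sphere_measure preimage_setT setTI -[X in _ * X]fineK// -EFinM mulVf//.
by rewrite gt_eqF// fine_gt0// B0.
Qed.

HB.instance Definition _ := Measure_isProbability.Build _ _ _ sphere_measure
  sphereT.

Lemma sphere_measure_unit_sphere : sphere_measure (@unit_sphere R d.+1) = 1.
Proof.
rewrite -sphereT /sphere_measure preimage_setT setTI; congr (_ * lambda _).
apply/seteqP; split=> x /=; first by case.
move=> xB; split=> //; case/andP: xB => x0 _.
have q0 : (0 < dotp x x)%R by rewrite -sqrtr_gt0.
rewrite /unit_sphere /= {1}/enorm.
suff -> : dotp (radial_proj x) (radial_proj x) = 1%R by rewrite sqrtr1.
transitivity ((enorm x ^+ 2)^-1 * dotp x x)%R.
  rewrite /dotp mulr_sumr; apply: eq_bigr => i _.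
  by rewrite !tnth_mktuple mulrACA mulrC -invfM -expr2.
by rewrite /enorm sqr_sqrtr ?ltW// mulVf// gt_eqF.
Qed.

End sphere_measure.

Section caps.
Variables (R : realType) (d : nat).
Local Notation point := (d.+1.-tuple R).

Definition cap (x : point) (phi : R) : set point :=
  [set y | unit_sphere y /\ cos phi < dotp x y].

Definition cap_count (X : {fset point}) (x : point) (phi : R) : nat :=
  #|` [fset y in X | y \in cap x phi]|%fset.

Definition number_variance (X : {fset point}) (phi : R) : \bar R :=
  (\int[@sphere_measure R d]_(x in @unit_sphere R d.+1)
    (((cap_count X x phi)%:R
       - #|` X|%:R * fine (sphere_measure (cap x phi))) ^+ 2)%:E)%E.

(* [limn_esup] is the extended-real limit superior, so the bound also asserts its
   finiteness. For fixed [t] only the large [N], for which the radius t N^(-1/d)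
   lies in [0, pi], matter. *)
Definition hyperuniform_threshold (X : nat -> {fset point}) : Prop :=
  exists C : R, \forall t \near +oo,
    (limn_esup (fun N => number_variance (X N) (t * N%:R `^ (- d%:R^-1)))
       <= (C * t ^+ d.-1)%:E)%E.

Definition uniformly_distributed (X : nat -> {fset point}) : Prop :=
  forall (x : point) (phi : R), unit_sphere x -> 0 <= phi <= pi ->
    (cap_count (X N) x phi)%:R / N%:R @[N --> \oo]
      --> fine (sphere_measure (cap x phi)).

End caps.

(* Main.v *)
(* For small caps of radius p and measure s, double counting the pairs (y, x)
   with y in X_N and x in C(y, p) gives, for a set K and its p-neighbourhood K',
       s * #(X_N & K) <= int_(K') #(X_N & C(x, p)) dx.
   With M = N s, AM-GM bounds the integrand by
       M + (#(X_N & C(x, p)) - M)^2 / k + k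
   for every k > 0, so that k = eta M gives
       #(X_N & K) / N <= sigma(K') + V / (eta M^2) + eta.
   For p = t N^(-1/d), hyperuniformity bounds V by O(t^(d-1)), while M is at
   least of order t^d. Letting N, then t, go to infinity and eta to 0 gives
   limsup #(X_N & K) / N <= sigma(K) for the closed cap and for the complement
   of the open cap, whose measures add up to 1 since the boundary is negligible.

   Rotation invariance of the cone measure is that of Lebesgue measure, which
   follows from the uniqueness of translation-invariant measures. *)

Require Import Defs.
From HB Require Import structures.
From mathcomp Require Import all_boot all_order all_algebra.
From mathcomp Require Import finmap.
From mathcomp Require Import all_classical all_reals all_analysis.
From mathcomp Require Import measurable_realfun.
From mathcomp Require Import ring lra.

Set Implicit Arguments.
Unset Strict Implicit.
Unset Printing Implicit Defensive.

Import Order.TTheory GRing.Theory Num.Theory.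
Import numFieldNormedType.Exports.

Local Open Scope classical_set_scope.
Local Open Scope ring_scope.

Lemma measurable_preimageT d1 d2 (T1 : measurableType d1)
    (T2 : measurableType d2) (f : T1 -> T2) (A : set T2) :
  measurable_fun setT f -> measurable A -> measurable (f @^-1` A).
Proof. by move=> mf mA; rewrite -[X in measurable X]setTI; exact: mf. Qed.

(** * Translation invariance of Lebesgue measure *)

Section lebesgue_translation.
Variable R : realType.

Definition translation (a : R) (x : measurableTypeR R) : measurableTypeR R :=
  a + x.

Lemma measurable_translation a : measurable_fun setT (translation a).
Proof. exact: measurable_funD. Qed.

(** The pushforward under a translation has the same values on half-open intervals, and these
    determine Lebesgue measure. *)
Lemma lebesgue_measure_shift a (A : set (measurableTypeR R)) :
  measurable A -> lebesgue_measure (translation a @^-1` A) = lebesgue_measure A.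
Proof.
move=> mA; rewrite -[LHS]/(pushforward lebesgue_measure (translation a) A).
apply/esym/lebesgue_measure_unique => //= [|_ _ [[p q]] _ <-].
  exact: measurable_translation.
rewrite /pushforward/= (_ : _ @^-1` _ = `]p - a, q - a]%classic).
  rewrite !lebesgue_measure_itv/= !lte_fin ltrD2 -!EFinB; case: ifP => // _.
  by congr EFin; ring.
by apply/seteqP; split=> x /=; rewrite /translation !in_itv/= ltrBlDl lerBrDl.
Qed.

Definition tuple_add n (a x : n.-tuple R) : n.-tuple R :=
  [tuple tnth a i + tnth x i | i < n].

Lemma measurable_tuple_add d (T : measurableType d) n (f g : T -> n.-tuple R) :
  measurable_fun setT f -> measurable_fun setT g ->
  measurable_fun setT (fun p => tuple_add (f p) (g p)).
Proof.
move=> mf mg; apply/measurable_fun_tnthP => i.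
rewrite (_ : _ \o _ = fun p => tnth (f p) i + tnth (g p) i); last first.
  by apply/funext => x /=; rewrite tnth_mktuple.
by apply: measurable_funD; apply: (measurableT_comp (@measurable_tnth _ _ _ i)).
Qed.

Definition translation_pair n (a : n.+1.-tuple R)
    (p : measurableTypeR R * n.-tuple R) : measurableTypeR R * n.-tuple R :=
  (translation (tuple_uncons a).1 p.1, tuple_add (tuple_uncons a).2 p.2).

Lemma measurable_translation_pair n (a : n.+1.-tuple R) :
  measurable_fun setT (translation_pair a).
Proof.
apply: measurable_fun_pair.
  exact: (measurableT_comp (measurable_translation _) measurable_fst).
by apply: measurable_tuple_add => //; exact: measurable_snd.
Qed.

Lemma tuple_add_cons n (a : n.+1.-tuple R) p :
  tuple_add a (tuple_cons p) = tuple_cons (translation_pair a p).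
Proof.
apply: eq_from_tnth => i; rewrite tnth_mktuple /tuple_cons.
case: (unliftP ord0 i) => [j ->|->]; rewrite ?tnthS ?tnth0/=; last by [].
rewrite tnth_mktuple; congr (_ + _).
by rewrite [in LHS](tuple_eta a) tnthS.
Qed.

(** By induction: [tuple_cons] turns a translation into a product of two translations, and a product
    measure is determined by its values on rectangles. *)
Lemma lebesgue_tuple_shift n (a : n.-tuple R) (A : set (n.-tuple R)) :
  measurable A ->
  lebesgue_tuple R n (tuple_add a @^-1` A) = lebesgue_tuple R n A.
Proof.
elim: n a A => [|n IHn] a A mA /=.
  suff -> : tuple_add a @^-1` A = A by [].
  by apply/seteqP; split=> x /=; rewrite (tuple0 (tuple_add a x)) (tuple0 x).
rewrite /lebesgue_step /pushforward -comp_preimage.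
have -> : tuple_add a \o @tuple_cons R n =
    @tuple_cons R n \o translation_pair a.
  by apply/funext => p /=; rewrite tuple_add_cons.
rewrite comp_preimage.
have := measurable_preimageT (@measurable_tuple_cons R n) mA.
move: (_ @^-1` A) => B mB {mA A}.
set m := lebesgue_tuple R n in IHn *.
rewrite -[LHS]/(pushforward (lebesgue_measure \x m)%E (translation_pair a) B).
apply/esym/product_measure_unique => //= [|_ C D mC mD].
  exact: measurable_translation_pair.
transitivity ((lebesgue_measure \x m)%E
  ((translation (tuple_uncons a).1 @^-1` C) `*`
   (tuple_add (tuple_uncons a).2 @^-1` D))); first by [].
rewrite product_measure1E.
- by congr (_ * _)%E; [exact: lebesgue_measure_shift|exact: IHn].
- exact: (measurable_preimageT (measurable_translation _)).
- by apply: measurable_preimageT => //; exact: measurable_tuple_add.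
Qed.

End lebesgue_translation.

(** * Reflections preserve Lebesgue measure *)

Section haar_unique.
Variable R : realType.
Local Open Scope ereal_scope.

Definition tuple_opp n (x : n.-tuple R) : n.-tuple R :=
  [tuple - tnth x i | i < n]%R.

Lemma measurable_tuple_opp n : measurable_fun setT (@tuple_opp n).
Proof.
apply/measurable_fun_tnthP => i.
rewrite (_ : _ \o _ = fun x => - tnth x i)%R; last first.
  by apply/funext => x /=; rewrite tnth_mktuple.
by apply: measurableT_comp => //; exact: measurable_tnth.
Qed.

Lemma product_measure12E d1 d2 (T1 : measurableType d1) (T2 : measurableType d2)
    (m1 : {sigma_finite_measure set T1 -> \bar R})
    (m2 : {sigma_finite_measure set T2 -> \bar R}) (A : set (T1 * T2)) :
  measurable A -> (m1 \x m2) A = (m1 \x^ m2) A.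
Proof.
by move=> mA; apply: product_measure_unique => // ? ? ? ? /=;
  rewrite product_measure2E.
Qed.

(** Evaluates the sheared sets of the uniqueness argument below, whose sections are translates of
    one fixed set. *)
Lemma product_measure1_const d1 d2 (T1 : measurableType d1)
    (T2 : measurableType d2) (m1 : {measure set T1 -> \bar R})
    (m2 : {measure set T2 -> \bar R}) (B : set T1) (S : set (T1 * T2)) c :
  0 <= c -> measurable B ->
  (forall x, x \in B -> m2 (xsection S x) = c) ->
  (forall x, x \notin B -> xsection S x = set0) ->
  (m1 \x m2) S = m1 B * c.
Proof.
move=> c0 mB SB SnB; rewrite /product_measure1.
rewrite (eq_integral (fun x => (\1_B x)%:E * c)); last first.
  move=> x _; rewrite indicE /=; have [xB|xB] := boolP (x \in B).
    by rewrite SB// mul1e.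
  by rewrite SnB// measure0 mul0e.
rewrite ge0_integralZr ?integral_indic ?setIT//; exact: measurableT_comp.
Qed.

Section sigma_finite_pack.
Context d (T : measurableType d) (m : {measure set T -> \bar R}).
Hypothesis sfm : sigma_finite setT m.

(** Attaches a proof of sigma-finiteness to a bare measure, so that the order of integration can be
    exchanged for it. *)
Definition sigma_finite_pack of sigma_finite setT m : set T -> \bar R := m.
HB.instance Definition _ := Measure.on (sigma_finite_pack sfm).
HB.instance Definition _ :=
  Measure_isSigmaFinite.Build _ _ _ (sigma_finite_pack sfm) sfm.
End sigma_finite_pack.

(* Both sides of m B * lebesgue A = m A * lebesgue B are the measure of
   {(x, y) | x \in B, x + y \in A}, up to the translation x := x - y. *)
Lemma shift_invariant_unique n (m : {measure set (n.-tuple R) -> \bar R})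
    (B A : set (n.-tuple R)) :
  sigma_finite setT m ->
  (forall a C, measurable C -> m (tuple_add a @^-1` C) = m C) ->
  measurable B -> (forall x, B (tuple_opp x) <-> B x) ->
  m B = lebesgue_tuple R n B -> 0 < m B < +oo ->
  measurable A -> m A = lebesgue_tuple R n A.
Proof.
move=> sfm.
pose m' : {sigma_finite_measure set (n.-tuple R) -> \bar R} :=
  sigma_finite_pack sfm.
move=> mshift mB Bopp mBE mB0 mA; set l := lebesgue_tuple R n in mBE *.
pose S := [set p : n.-tuple R * n.-tuple R | B p.1 /\ A (tuple_add p.1 p.2)].
pose S' := [set p : n.-tuple R * n.-tuple R |
  A p.1 /\ B (tuple_add (tuple_opp p.1) p.2)].
have mS : measurable S.
  by apply: measurableI; apply: measurable_preimageT => //;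
    exact: measurable_tuple_add.
have mS' : measurable S'.
  apply: measurableI; apply: measurable_preimageT => //.
  apply: measurable_tuple_add => //.
  by apply: (measurableT_comp (@measurable_tuple_opp n)).
have SE : (m \x l) S = m B * l A.
  apply: product_measure1_const => // x.
    rewrite inE => xB; rewrite -(lebesgue_tuple_shift x mA) -/l; congr (l _).
    by apply/seteqP; split=> y; rewrite /xsection/= inE /S/= => // -[].
  rewrite notin_setE => xB; apply/seteqP; split=> y //.
  by rewrite /xsection/= inE /S/= => -[].
have S'E : (m \x l) S' = m A * l B.
  apply: product_measure1_const => // x.
    rewrite inE => xA; rewrite -(lebesgue_tuple_shift (tuple_opp x) mB) -/l;
      congr (l _).
    by apply/seteqP; split=> y; rewrite /xsection/= inE /S'/= => // -[].
  rewrite notin_setE => xA; apply/seteqP; split=> y //.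
  by rewrite /xsection/= inE /S'/= => -[].
have : (m \x l) S = (m \x l) S'.
  rewrite !(product_measure12E m')//; apply: eq_integral => y _ /=.
  rewrite -[LHS](mshift (tuple_opp y)); last exact: measurable_ysection.
  have addK x : tuple_add (tuple_add (tuple_opp y) x) y = x.
    by apply: eq_from_tnth => i; rewrite !tnth_mktuple addrAC addNr add0r.
  have oppD x :
      tuple_opp (tuple_add (tuple_opp x) y) = tuple_add (tuple_opp y) x.
    by apply: eq_from_tnth => i; rewrite !tnth_mktuple opprD opprK addrC.
  (* After the translation, the two slices at y read (x - y in B, x in A) and (x in A, y - x in B);
     they agree by the symmetry of B. *)
  congr (m _); apply/seteqP; split=> x; rewrite /ysection/= !inE /S /S'/=;
    by rewrite -(Bopp (tuple_add (tuple_opp x) y)) oppD addK => -[].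
have [B0 Boo] := andP mB0.
have Bfin : m B \is a fin_num by rewrite ge0_fin_numE// ltW.
rewrite SE S'E -mBE muleC => h.
by apply/eqP; rewrite eq_le -(lee_pmul2r Bfin B0 (m A) (l A))
  -(lee_pmul2r Bfin B0 (l A) (m A)) h lexx.
Qed.

End haar_unique.

(** * Inner products and reflections *)

Section reflection.
Variables (R : realType) (n : nat).
Implicit Types (u x y z w : n.-tuple R).

Lemma dotpC x y : dotp x y = dotp y x.
Proof. by apply: eq_bigr => i _; rewrite mulrC. Qed.

Lemma dotp_add x y z : dotp x (tuple_add y z) = dotp x y + dotp x z.
Proof.
by rewrite -big_split; apply: eq_bigr => i _; rewrite tnth_mktuple mulrDr.
Qed.

Definition tuple_scale (a : R) x : n.-tuple R := [tuple a * tnth x i | i < n].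

Lemma dotp_scale x (a : R) y : dotp x (tuple_scale a y) = a * dotp x y.
Proof.
by rewrite mulr_sumr; apply: eq_bigr => i _; rewrite tnth_mktuple mulrCA.
Qed.

Lemma dotp_opp x y : dotp x (tuple_opp y) = - dotp x y.
Proof.
by rewrite -sumrN; apply: eq_bigr => i _; rewrite tnth_mktuple mulrN.
Qed.

Lemma dotp_ge0 x : 0 <= dotp x x.
Proof. by apply: sumr_ge0 => i _; rewrite -expr2 sqr_ge0. Qed.

Lemma dotp_eq0 x : dotp x x = 0 -> forall i, tnth x i = 0.
Proof.
move=> /eqP; rewrite psumr_eq0 => [/allP h i|i _];
  last by rewrite -expr2 sqr_ge0.
by have := h i (mem_index_enum _); rewrite mulf_eq0 orbb => /eqP.
Qed.

Lemma measurable_dotpr x : measurable_fun setT (dotp x).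
Proof.
apply: measurable_sum => i; apply: measurable_funM => //;
  exact: measurable_tnth.
Qed.

(* When u = 0 the coefficient 2 / 0 is 0, and the map is the identity. *)
Definition reflection u z : n.-tuple R :=
  tuple_add z (tuple_scale (- (2 / dotp u u * dotp u z)) u).

Lemma dotp_reflection u w z :
  dotp w (reflection u z) = dotp w z - 2 / dotp u u * dotp u z * dotp w u.
Proof. by rewrite dotp_add dotp_scale mulNr. Qed.

(** A form of the cancellation that survives u = 0, so that isometry and involutivity follow without
    a case distinction. *)
Lemma reflection_coef u :
  2 / dotp u u * (2 / dotp u u * dotp u u) = 2 / dotp u u * 2.
Proof.
have [->|u0] := eqVneq (dotp u u) 0; first by rewrite invr0 !mulr0 !mul0r.
by rewrite divfK.
Qed.

Lemma reflection_isometry u z w :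
  dotp (reflection u z) (reflection u w) = dotp z w.
Proof.
rewrite dotp_reflection ![dotp (reflection u z) _]dotpC !dotp_reflection.
rewrite [dotp w z]dotpC [dotp w u]dotpC.
have := reflection_coef u; set k := 2 / _ => h.
transitivity (dotp z w - (k * 2 - k * (k * dotp u u)) * dotp u z * dotp u w);
  first by ring.
by rewrite h subrr; ring.
Qed.

Lemma reflectionK u : involutive (reflection u).
Proof.
move=> z; apply: eq_from_tnth => i; rewrite !tnth_mktuple dotp_reflection.
have := reflection_coef u; set k := 2 / _ => h.
transitivity (tnth z i - (k * 2 - k * (k * dotp u u)) * dotp u z * tnth u i);
  first by ring.
by rewrite h subrr; ring.
Qed.

Lemma reflection_add u z w :
  reflection u (tuple_add z w) = tuple_add (reflection u z) (reflection u w).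
Proof.
apply: eq_from_tnth => i; rewrite !tnth_mktuple dotp_add; ring.
Qed.

(** For u = x - y, equality of norms gives |u|^2 = 2 <u, x>; the coefficient is then 1, and x goes
    to x - u = y. *)
Lemma reflection_swap x y : dotp x x = dotp y y ->
  reflection (tuple_add x (tuple_opp y)) x = y.
Proof.
move=> xy; set u := tuple_add _ _.
have ux : dotp u x = dotp x x - dotp x y by rewrite dotpC dotp_add dotp_opp.
have uu : dotp u u = 2 * dotp u x.
  by rewrite {2}/u dotp_add dotp_opp ux [dotp u y]dotpC dotp_add dotp_opp -xy
    (dotpC y); ring.
apply: eq_from_tnth => i; rewrite !tnth_mktuple.
have [u0|u0] := eqVneq (dotp u u) 0.
  have := dotp_eq0 u0 i; rewrite !tnth_mktuple => /eqP;
    rewrite subr_eq0 => /eqP ->.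
  by rewrite subrr mulr0 addr0.
rewrite uu invfM mulrA divff// mul1r mulVf; first by ring.
by move: u0; rewrite uu mulf_eq0 negb_or => /andP[].
Qed.

Lemma measurable_reflection u : measurable_fun setT (reflection u).
Proof.
apply: measurable_tuple_add => //; apply/measurable_fun_tnthP => i.
rewrite (_ : _ \o _ = fun z => - (2 / dotp u u * dotp u z) * tnth u i);
  last first.
  by apply/funext => x /=; rewrite tnth_mktuple.
apply: measurable_funM => //; apply: measurableT_comp => //.
by apply: measurable_funM => //; exact: measurable_dotpr.
Qed.

End reflection.

(** The pushforward under a reflection is again translation invariant, by linearity, and has the
    same value on the punctured ball, by isometry. This set is symmetric, of positive finite
    measure, so uniqueness applies. *)
Lemma lebesgue_tuple_reflection (R : realType) n (u : n.+1.-tuple R)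
    (A : set (n.+1.-tuple R)) : measurable A ->
  lebesgue_tuple R n.+1 (reflection u @^-1` A) = lebesgue_tuple R n.+1 A.
Proof.
move=> mA; set l := lebesgue_tuple R n.+1.
have mpre C : measurable C -> measurable (reflection u @^-1` C).
  by apply: measurable_preimageT; exact: measurable_reflection.
have sf : sigma_finite setT (pushforward l (reflection u)).
  have [F TF Foo] := sigma_finiteT l.
  exists (fun i => reflection u @^-1` F i).
    by rewrite -preimage_bigcup -TF preimage_setT.
  move=> i; have [mF Fi] := Foo i; split; first exact: mpre.
  rewrite /pushforward -comp_preimage (_ : _ \o _ = id)//.
  by apply/funext => x /=; exact: reflectionK.
have ballE : pushforward l (reflection u) (@punctured_ball R n.+1) =
    l (@punctured_ball R n.+1).
  congr (l _); apply/seteqP.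
  by split => x; rewrite /punctured_ball /= /enorm reflection_isometry.
rewrite -[LHS]/(pushforward l (reflection u) A).
apply: (@shift_invariant_unique _ _ _ (@punctured_ball R n.+1)) => //=.
- exact: measurable_reflection.
- move=> _ a C mC /=; rewrite /pushforward.
  (* Reflecting and then adding [a] is the same as adding [reflection u a] and then reflecting. *)
  rewrite -[RHS](lebesgue_tuple_shift (reflection u a)); last exact: mpre.
  congr (l _); apply/seteqP; split => x /=;
    by rewrite reflection_add reflectionK.
- exact: measurable_punctured_ball.
- by move=> x; rewrite /punctured_ball /= /enorm dotp_opp dotpC dotp_opp opprK.
- by move=> _; rewrite ballE punctured_ball_gt0 punctured_ball_fin.
Qed.

(** * The cone measure on the sphere *)

Section sphere_rotation.
Variables (R : realType) (d : nat).
Implicit Types x y z : d.+1.-tuple R.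
Local Notation sigma := (@sphere_measure R d).

Lemma dotp_unit x : unit_sphere x -> dotp x x = 1.
Proof.
rewrite /unit_sphere /= /enorm => x1.
by rewrite -(sqr_sqrtr (dotp_ge0 x)) x1 expr1n.
Qed.

Lemma dotp_radial_proj x z : dotp x (radial_proj z) = dotp x z / enorm z.
Proof.
by rewrite /dotp mulr_suml; apply: eq_bigr => i _; rewrite tnth_mktuple mulrA.
Qed.

Lemma measurable_dotp_preimage x (D : set R) : measurable D ->
  measurable (dotp x @^-1` D).
Proof. by apply: measurable_preimageT; exact: measurable_dotpr. Qed.

Lemma measurable_unit_sphere : measurable (@unit_sphere R d.+1).
Proof.
rewrite (_ : unit_sphere (n:=d.+1) = @enorm R d.+1 @^-1` [set 1])//.
exact: measurable_preimageT (@measurable_enorm _ _) _.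
Qed.

(** The measure lives on the ambient space, where the complement of the sphere is null; caps can
    thus be replaced by half-spaces. *)
Lemma sphere_measureI_unit_sphere (A : set (d.+1.-tuple R)) : measurable A ->
  sigma (@unit_sphere R d.+1 `&` A) = sigma A.
Proof.
move=> mA; have mU := measurable_unit_sphere.
have U0 : sigma (~` @unit_sphere R d.+1) = 0.
  rewrite probability_setC//.
  by rewrite [X in (1 - X)%E](@sphere_measure_unit_sphere R d) subee.
rewrite -[in RHS](setIT A) -(setUv (@unit_sphere R d.+1)) setIUr setIC.
have mUC : measurable (~` @unit_sphere R d.+1) by exact: measurableC.
rewrite measureU0//; [exact: measurableI|exact: measurableI|].
apply: (subset_measure0 _ mUC (@subIsetr _ _ _) U0) => //; exact: measurableI.
Qed.

(** Rotation invariance for sets given by the inner product with one point: the reflection taking x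
    to y preserves norms and volume, and carries one cone to the other. *)
Lemma sphere_measure_dotp x y (D : set R) : unit_sphere x -> unit_sphere y ->
  measurable D -> sigma (dotp x @^-1` D) = sigma (dotp y @^-1` D).
Proof.
move=> x1 y1 mD; pose T := reflection (tuple_add x (tuple_opp y)).
have Tx : T x = y by apply: reflection_swap; rewrite !dotp_unit.
rewrite /sphere_measure; congr (_ * _)%E.
rewrite -[RHS](@lebesgue_tuple_reflection _ _ (tuple_add x (tuple_opp y))) -/T;
  last first.
  apply: measurableI; last exact: measurable_punctured_ball.
  apply: (measurable_preimageT (@measurable_radial_proj _ _)).
  exact: measurable_dotp_preimage.
congr (lebesgue_tuple _ _ _); apply/seteqP.
have TE z : enorm (T z) = enorm z by rewrite /enorm reflection_isometry.
by split => z /=; rewrite /punctured_ball/= !dotp_radial_proj TE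
  -[in dotp y _]Tx reflection_isometry.
Qed.

Lemma cap_dotp x phi :
  cap x phi = @unit_sphere R d.+1 `&` dotp x @^-1` `]cos phi, +oo[.
Proof. by apply/seteqP; split => y /=; rewrite in_itv/= andbT. Qed.

Lemma sphere_measure_cap x phi :
  sigma (cap x phi) = sigma (dotp x @^-1` `]cos phi, +oo[).
Proof.
rewrite cap_dotp sphere_measureI_unit_sphere//; exact: measurable_dotp_preimage.
Qed.

Lemma measurable_cap x phi : measurable (cap x phi).
Proof.
rewrite cap_dotp; apply: measurableI; first exact: measurable_unit_sphere.
exact: measurable_dotp_preimage.
Qed.

Lemma sphere_measure_cap_eq x y phi : unit_sphere x -> unit_sphere y ->
  sigma (cap x phi) = sigma (cap y phi).
Proof.
by move=> x1 y1; rewrite !sphere_measure_cap; exact: sphere_measure_dotp.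
Qed.

(** The pole for explicit computations: [lebesgue_tuple] splits off the first coordinate, so cones
    around this axis suit its product structure. *)
Definition basis0 : d.+1.-tuple R := [tuple (i == ord0)%:R | i < d.+1].

Lemma dotp_basis0 z : dotp basis0 z = tnth z ord0.
Proof.
rewrite /dotp (bigD1 ord0)//= tnth_mktuple eqxx mul1r big1 ?addr0// => i i0.
by rewrite tnth_mktuple (negbTE i0) mul0r.
Qed.

Lemma basis0_unit : unit_sphere basis0.
Proof.
by rewrite /unit_sphere /= /enorm dotp_basis0 tnth_mktuple eqxx sqrtr1.
Qed.

Lemma dotp_cons (a b : measurableTypeR R) (v w : d.-tuple R) :
  dotp (tuple_cons (a, v)) (tuple_cons (b, w)) = a * b + dotp v w.
Proof.
rewrite /dotp big_ord_recl !tnth0; congr (_ + _).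
by apply: eq_bigr => i _; rewrite !tnthS.
Qed.

Lemma enorm_cons (a : measurableTypeR R) (w : d.-tuple R) :
  enorm (tuple_cons (a, w)) = Num.sqrt (a ^+ 2 + dotp w w).
Proof. by rewrite /enorm dotp_cons. Qed.

(* The cone over a level set meets each line parallel to the first axis, other
   than the axis itself, in at most one point. *)
Lemma level_uniq (c q a b : R) : 0 < q ->
  a / Num.sqrt (a ^+ 2 + q) = c -> b / Num.sqrt (b ^+ 2 + q) = c -> a = b.
Proof.
move=> q0.
have n0 (e : R) : 0 < Num.sqrt (e ^+ 2 + q)
  by rewrite sqrtr_gt0 ltr_wpDl ?sqr_ge0.
have n2 (e : R) : Num.sqrt (e ^+ 2 + q) ^+ 2 = e ^+ 2 + q.
  by rewrite sqr_sqrtr// addr_ge0 ?sqr_ge0// ltW.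
move=> ha hb; have := n2 a; have := n2 b; have := n0 a; have := n0 b.
move: ha hb; set m := Num.sqrt _; set n := Num.sqrt _ => ha hb m0 n0' em en.
have {}ha : a = c * m by rewrite -ha divfK// gt_eqF.
have {}hb : b = c * n by rewrite -hb divfK// gt_eqF.
have h : (1 - c ^+ 2) * (m ^+ 2 - n ^+ 2) = 0.
  by rewrite mulrBl mul1r mulrBr -!exprMn -ha -hb em en; ring.
move/eqP : h; rewrite mulf_eq0 => /orP[/eqP c1|].
  have : m ^+ 2 = c ^+ 2 * m ^+ 2 + q by rewrite -exprMn -ha en.
  have -> : c ^+ 2 = 1 by move/eqP: c1; rewrite subr_eq0 => /eqP.
  by move=> ?; exfalso; move: q0; lra.
rewrite subr_eq0 eqrXn2 ?ltW// => /eqP mn.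
by rewrite ha hb mn.
Qed.

(** Makes the boundary of a cap negligible. With x rotated to the first axis, the cone is sliced by
    lines parallel to that axis; almost every slice has at most one point. *)
Lemma sphere_measure_level x (c : R) : (0 < d)%N -> unit_sphere x ->
  sigma [set y | dotp x y = c] = 0.
Proof.
move=> d0 x1.
rewrite (_ : [set y | _] = dotp x @^-1` [set c])//.
rewrite (sphere_measure_dotp x1 basis0_unit)//.
rewrite /sphere_measure; set E := _ `&` _.
have mE : measurable E.
  apply: measurableI; last exact: measurable_punctured_ball.
  apply: (measurable_preimageT (@measurable_radial_proj _ _)).
  exact: measurable_dotp_preimage.
suff -> : lebesgue_tuple R d.+1 E = 0%E by rewrite mule0.
rewrite /= /lebesgue_step /pushforward product_measure12E; last first.
  exact: (measurable_preimageT (@measurable_tuple_cons _ _)).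
(* The exceptional line is the axis itself, w = 0; it is negligible because d >= 1. *)
have W00 : lebesgue_tuple R d
    [set w : d.-tuple R | forall i, [set 0] (tnth w i)] = 0%E.
  rewrite lebesgue_tuple_cube// lebesgue_measure_set1.
  by case: (d) d0 => // k _; rewrite expeS mul0e.
have mW : measurable [set w : d.-tuple R | forall i, [set 0] (tnth w i)].
  by apply: measurable_cube.
rewrite /product_measure2.
transitivity (\int[lebesgue_tuple R d]_w (cst 0 w))%E;
  last by rewrite integral0.
apply: ae_eq_integral => //.
  by apply: measurable_fun_ysection;
    exact: (measurable_preimageT (@measurable_tuple_cons _ _)).
exists [set w | forall i, [set 0] (tnth w i)];
  split => // w /= /not_implyP[_ Ew].
apply: contrapT => w0; apply: Ew.
have q0 : 0 < dotp w w.
  rewrite lt_neqAle dotp_ge0 andbT eq_sym; apply/eqP => /dotp_eq0 h; exact: w0.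
set S := ysection _ _.
have [->|/set0P[a Sa]] := eqVneq S set0; first by rewrite measure0.
have aux b : S b -> b / Num.sqrt (b ^+ 2 + dotp w w) = c.
  rewrite /S /ysection /= inE => -[/=].
  by rewrite dotp_radial_proj dotp_basis0 enorm_cons tnth0.
have SS : S = [set a].
  apply/seteqP; split => [b Sb|b ->//] /=.
  exact: (level_uniq q0 (aux _ Sb) (aux _ Sa)).
by rewrite SS; exact: lebesgue_measure_set1.
Qed.

End sphere_rotation.

(** * Measure of small caps *)

Section cap_lower_bound.
Variable R : realType.

(** By the mean value theorem, sin p / p is a value of cos on ]0, p[, hence at least cos 1. *)
Lemma sin_ge_linear (p : R) : 0 < p <= 1 -> cos 1 * p <= sin p.
Proof.
move=> /andP[p0 p1].
have [|c cp] := @MVT R sin cos 0 p p0 (fun x _ => is_derive_sin x).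
  by apply: continuous_subspaceT => x; exact: continuous_sin.
move: cp; rewrite in_itv/= => /andP[c0 cp].
rewrite sin0 !subr0 => ->; rewrite ler_pM2r//.
have pi1 : 1 <= (pi : R) by rewrite (le_trans _ (pi_ge2 R))// ler1n.
by apply: ltW; rewrite ltr_cos ?in_itv/=; lra.
Qed.

(* The box [1/2, 3/4] x [0, k p]^d, with k = cos 1 / (2 (d + 1)), lies in the
   cone over the cap of radius p around the first basis vector. *)
Lemma cap_cone (d : nat) (p a q : R) : 0 < p <= 1 -> 1 / 2 <= a <= 3 / 4 ->
  0 <= q -> q <= d%:R * (cos 1 / (2 * d.+1%:R) * p) ^+ 2 ->
  [/\ 0 < a ^+ 2 + q, a ^+ 2 + q <= 1 & cos p * Num.sqrt (a ^+ 2 + q) < a].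
Proof.
move=> p01 /andP[a1 a2] q0 qle; have sp := sin_ge_linear p01.
have /andP[p0 p1] := p01.
have c1 := cos1_gt0 R; have c2 := cos_le1 (1 : R).
have : d.+1%:R = d%:R + 1 :> R by rewrite natr1.
have d0 : 0 <= (d%:R : R) by [].
move: (d.+1%:R : R) qle => m qle md.
have m0 : 0 < m by lra.
(* The bound on q equals (cos 1 * p)^2 / 4 times d / (d + 1)^2, and the last factor is below 1. *)
have qlt : q < (sin p) ^+ 2 / 4.
  apply: (le_lt_trans qle); apply: (@lt_le_trans _ _ ((cos 1 * p) ^+ 2 / 4));
    last first.
    rewrite ler_pM2r ?invr_gt0// ler_pXn2r ?nnegrE//;
      first by rewrite mulr_ge0// ltW.
    by rewrite (le_trans _ sp)// mulr_ge0// ltW.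
  rewrite (_ : d%:R * _ = (cos 1 * p) ^+ 2 / 4 * (d%:R / m ^+ 2)); last first.
    by rewrite !exprMn exprVn exprMn; field; rewrite gt_eqF.
  rewrite gtr_pMr; last by rewrite divr_gt0// exprn_gt0// mulr_gt0.
  rewrite ltr_pdivrMr ?exprn_gt0// mul1r md; nra.
have s2 : (sin p) ^+ 2 <= 1 by rewrite sin2cos2 gerBl sqr_ge0.
have a20 : 1 / 4 <= a ^+ 2 by nra.
have a21 : a ^+ 2 <= 9 / 16 by nra.
split; [lra|lra|].
have n0 : 0 < Num.sqrt (a ^+ 2 + q) by rewrite sqrtr_gt0; lra.
have n2 : Num.sqrt (a ^+ 2 + q) ^+ 2 = a ^+ 2 + q by rewrite sqr_sqrtr; lra.
(* Squaring the negation yields sin^2 p * a^2 <= q, against q < sin^2 p / 4 and a^2 >= 1/4. *)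
rewrite ltNge; apply/negP => h.
have : a ^+ 2 <= (cos p * Num.sqrt (a ^+ 2 + q)) ^+ 2.
  by rewrite ler_pXn2r ?nnegrE//; lra.
rewrite exprMn n2 cos2sin2 mulrBl mul1r => h2.
have : (sin p) ^+ 2 * (1 / 4) <= (sin p) ^+ 2 * a ^+ 2
  by rewrite ler_wpM2l// sqr_ge0.
have : 0 <= (sin p) ^+ 2 * q by rewrite mulr_ge0// sqr_ge0.
rewrite mulrDr in h2; lra.
Qed.

Lemma sphere_measure_cap_ge (d : nat) : exists2 c : R, 0 < c &
  forall x p, unit_sphere x -> 0 < p <= 1 ->
    ((c * p ^+ d)%:E <= @sphere_measure R d (cap x p))%E.
Proof.
set lB := fine (lebesgue_tuple R d.+1 (@punctured_ball R d.+1)).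
have lB0 : 0 < lB by rewrite fine_gt0// punctured_ball_gt0 punctured_ball_fin.
pose k : R := cos 1 / (2 * d.+1%:R).
have k0 : 0 < k by rewrite divr_gt0// ?cos1_gt0// mulr_gt0.
(* [lB] normalises the cone measure, 1/4 is the length of [1/2, 3/4], and k p is the length of the
   other d edges of the box. *)
exists (lB^-1 * (4^-1 * k ^+ d)) => [|x p x1 p01].
  by rewrite !mulr_gt0 ?invr_gt0// exprn_gt0.
have p0 : 0 < p by case/andP: p01.
rewrite (sphere_measure_cap_eq _ x1 (basis0_unit R d)) sphere_measure_cap.
rewrite /sphere_measure -/lB -mulrA EFinM lee_wpmul2l//.
  by rewrite lee_fin invr_ge0 ltW.
set E := _ `&` _.
have mE : measurable E.
  apply: measurableI; last exact: measurable_punctured_ball.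
  apply: (measurable_preimageT (@measurable_radial_proj _ _)).
  exact: measurable_dotp_preimage.
pose D : set R := `[0, k * p]%classic.
pose D0 : set R := `[1 / 2, 3 / 4]%classic.
pose Dd := [set w : d.-tuple R | forall i, D (tnth w i)].
have mDd : measurable Dd by apply: measurable_cube; exact: measurable_itv.
rewrite /= /lebesgue_step /pushforward.
apply: (@le_trans _ _ ((lebesgue_measure \x lebesgue_tuple R d)%E
   ((D0 : set (measurableTypeR R)) `*` Dd))).
  rewrite product_measure1E//; last exact: measurable_itv.
  rewrite /Dd lebesgue_tuple_cube; last exact: measurable_itv.
  rewrite /D0 /D !lebesgue_measure_itv/= lte_fin mulr_gt0//
    lebesgue_measure_itv/= lte_fin -!EFinB.
  rewrite ifT; last by lra.
  rewrite subr0 -EFin_expe -EFinM lee_fin [(k * p) ^+ d]exprMn mulrA.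
  by have -> : 3 / 4 - 1 / 2 = 4^-1 :> R by lra.
apply: le_measure; rewrite ?inE.
- by apply: measurableX => //; exact: measurable_itv.
- exact: (measurable_preimageT (@measurable_tuple_cons _ _)).
move=> x0; case: x0 => a w [/= aD wD]; move: aD; rewrite /D0 /= in_itv/= => aD.
have [|h1 h2 h3] := @cap_cone d p a (dotp w w) p01 aD (dotp_ge0 w).
  rewrite -/k mulr_natl -[d in leRHS]card_ord -sumr_const.
  apply: ler_sum => i _; have := wD i; rewrite /D/= in_itv/= => /andP[w0 w1].
  by rewrite -expr2 ler_pXn2r ?nnegrE// mulr_ge0 ?ltW.
split => /=.
  rewrite dotp_radial_proj dotp_basis0 enorm_cons tnth0 in_itv/= andbT.
  by rewrite ltr_pdivlMr// sqrtr_gt0.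
rewrite /punctured_ball /= enorm_cons sqrtr_gt0 h1/=.
by rewrite -[leRHS]sqrtr1 ler_wsqrtr.
Qed.

End cap_lower_bound.

(** * Counting points with the number variance *)

Section counting.
Variables (R : realType) (d : nat).
Local Notation point := (d.+1.-tuple R).
Local Notation sigma := (@sphere_measure R d).
Local Notation U := (@unit_sphere R d.+1).
Implicit Types (X : {fset point}) (x y : point) (K : set point).

(** Extends [cap_count], which is the case of a cap by conversion, to half-spaces. *)
Definition count_in X K : nat := #|` [fset y in X | y \in K]|%fset.

Lemma count_inE X K : (count_in X K)%:R = \sum_(y <- X) \1_K y :> R.
Proof.
rewrite /count_in card_fset_sum1 -big_fset_condE natr_sum big_mkcond/=.
by apply: eq_bigr => y _; rewrite indicE; case: (_ \in _).
Qed.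

Lemma cap_sym x y phi : U x -> U y -> (y \in cap x phi) = (x \in cap y phi).
Proof.
by move=> x1 y1; apply/idP/idP; rewrite !inE => -[_ h]; split=> //;
  rewrite dotpC.
Qed.

(** Symmetry of the relation y in C(x, phi) makes the count a sum of indicators in the variable x,
    ready to be integrated term by term. *)
Lemma cap_countE X x phi : [set` X] `<=` U -> U x ->
  (cap_count X x phi)%:R = \sum_(y <- X) \1_(cap y phi) x :> R.
Proof.
move=> XU x1; rewrite -[cap_count _ _ _]/(count_in X (cap x phi)) count_inE.
rewrite !big_seq; apply: eq_bigr => y yX; rewrite !indicE cap_sym//.
exact: XU.
Qed.

Lemma count_le_variance X phi K Kp e (k : R) : [set` X] `<=` U -> U e ->
  0 < k -> measurable Kp ->
  (forall x y, U x -> U y -> K y -> cap y phi x -> Kp x) ->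
  let s := fine (sigma (cap e phi)) in let M := #|` X|%:R * s in
  (((count_in X K)%:R * s)%:E <=
    M%:E * sigma Kp + (k^-1%:E * number_variance X phi + k%:E))%E.
Proof.
move=> XU e1 k0 mKp KKp.
(* The AM-GM bound, used below with t = g x - M. *)
have kv (t : R) : t <= k^-1 * t ^+ 2 + k.
  by rewrite -(ler_pM2l k0) [leRHS]mulrDr mulVKf ?gt_eqF//; nra.
move=> /=; set s := fine _; set M := #|` X|%:R * s.
have mU := @measurable_unit_sphere R d.
have sE x : U x -> sigma (cap x phi) = s%:E.
  by move=> x1; rewrite (sphere_measure_cap_eq _ x1 e1) fineK//
    fin_num_measure//; exact: measurable_cap.
have s0 : 0 <= s by exact: fine_ge0.
have M0 : 0 <= M by rewrite mulr_ge0.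
pose g x : R := \sum_(y <- X) \1_(cap y phi) x.
have mind y : measurable_fun setT (\1_(cap y phi) : point -> R).
  by apply: measurable_indic; exact: measurable_cap.
have mg : measurable_fun setT g by apply: measurable_sum => y.
have VE : number_variance X phi = (\int[sigma]_(x in U) ((g x - M) ^+ 2)%:E)%E.
  apply: eq_integral => x; rewrite inE => x1.
  by rewrite (cap_countE _ XU x1) (sE x x1).
have gE x : g x = \sum_(y <- X) \1_(cap y phi) x by [].
clearbody g M s.
(* Double counting: integrating over x first, each y of X in K contributes the measure s of its
   cap. *)
have -> : ((count_in X K)%:R * s)%:E =
    (\int[sigma]_(x in U) (\sum_(y <- X) (\1_K y * \1_(cap y phi) x))%:E)%E.
  under eq_integral do rewrite -sumEFin.
  rewrite (@ge0_integral_sum _ _ _ sigma U mU _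
    (fun y x => (\1_K y * \1_(cap y phi) x)%:E)); last 2 first.
  - move=> y; apply/measurable_EFinP; apply: measurable_funTS.
    exact: measurable_funM.
  - by move=> y x _; rewrite lee_fin mulr_ge0.
  rewrite count_inE mulr_suml -sumEFin !big_seq; apply: eq_bigr => y yX.
  under eq_integral do rewrite EFinM.
  rewrite ge0_integralZl_EFin; last 4 first.
  - exact: mU.
  - by move=> x _; rewrite lee_fin.
  - by apply/measurable_EFinP; apply: measurable_funTS.
  - by [].
  rewrite (integral_indic _ mU); last exact: measurable_cap.
  rewrite setIidl; last by move=> x [].
  by rewrite EFinM -(sE y (XU y yX)).
have mKU : measurable_fun U (fun x => (M * \1_Kp x)%:E).
  apply/measurable_EFinP; apply: measurable_funTS.
  by apply: measurable_funM; [exact: measurable_cst|exact: measurable_indic].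
have mVU : measurable_fun U (fun x => (k^-1 * (g x - M) ^+ 2)%:E).
  apply/measurable_EFinP; apply: measurable_funTS.
  apply: measurable_funM; first exact: measurable_cst.
  by apply: measurable_funX; apply: (measurable_funB mg); exact: measurable_cst.
apply: (@le_trans _ _ (\int[sigma]_(x in U)
   ((M * \1_Kp x)%:E + ((k^-1 * (g x - M) ^+ 2)%:E + k%:E)))%E).
  apply: ge0_le_integral; first exact: mU.
  - by move=> x _; rewrite lee_fin sumr_ge0// => y _; rewrite mulr_ge0.
  - apply/measurable_EFinP; apply: measurable_funTS.
    by apply: measurable_sum => y; exact: measurable_funM.
  - by apply: (emeasurable_funD mKU); apply: (emeasurable_funD mVU);
      exact: measurable_cst.
  move=> x x1; rewrite -!EFinD lee_fin.
  have [xK|xK] := boolP (x \in Kp).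
    rewrite indicE xK mulr1 -lerBlDl (le_trans _ (kv _))// lerB// gE.
    apply: ler_sum => y _.
    by rewrite !indicE; case: (_ \in K); rewrite ?mul1r ?mul0r.
  (* Outside [Kp] the left side vanishes: a nonzero term would put x in the cap around a point of
     K. *)
  rewrite big_seq big1 => [|y yX].
    rewrite addr_ge0 ?mulr_ge0// addr_ge0 ?(ltW k0)//.
    by rewrite mulr_ge0 ?invr_ge0 ?sqr_ge0 ?(ltW k0).
  rewrite !indicE; have [yK|] := boolP (y \in K); rewrite ?mul0r//.
  have [xy|] := boolP (x \in cap y phi); rewrite ?mulr0//.
  move: xK; rewrite notin_setE => xK; exfalso; apply: xK.
  by move: yK xy; rewrite !inE => yK xy; apply: KKp yK xy => //; exact: XU.
have VU : measurable_fun U (fun x => ((g x - M) ^+ 2)%:E).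
  apply/measurable_EFinP; apply: measurable_funTS.
  by apply: measurable_funX; apply: (measurable_funB mg); exact: measurable_cst.
have mk : measurable_fun U (fun=> k%:E : \bar R) by exact: measurable_cst.
have V0 x : U x -> (0 <= (k^-1 * (g x - M) ^+ 2)%:E)%E.
  by move=> _; rewrite lee_fin mulr_ge0 ?invr_ge0 ?sqr_ge0 ?ltW.
have k0' x : U x -> (0 <= k%:E)%E by move=> _; rewrite lee_fin ltW.
rewrite (ge0_integralD _ mU _ mKU _ (emeasurable_funD mVU mk)); last 2 first.
- by move=> x _; rewrite lee_fin mulr_ge0.
- by move=> x x1; rewrite adde_ge0 ?V0 ?(k0' x).
rewrite (ge0_integralD _ mU V0 mVU k0' mk).
rewrite (integral_cst _ mU) [X in (_ * X)%E](@sphere_measure_unit_sphere R d)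
  mule1.
under eq_integral do rewrite EFinM.
rewrite ge0_integralZl_EFin; last 4 first.
- exact: mU.
- by move=> x _; rewrite lee_fin.
- by apply/measurable_EFinP; apply: measurable_funTS; exact: measurable_indic.
- exact: M0.
under [X in (_ + (X + _))%E]eq_integral do rewrite EFinM.
rewrite (ge0_integralZl_EFin _ mU _ VU); last 2 first.
- by move=> x _; rewrite lee_fin sqr_ge0.
- by rewrite invr_ge0 ltW.
rewrite VE leeD2r// lee_wpmul2l// (integral_indic _ mU)//.
apply: le_measure; rewrite ?inE//; exact: measurableI.
Qed.

End counting.

(** * Upper density of closed half-spaces under hyperuniformity *)

Lemma limn_esup_lt (R : realType) (u : (\bar R)^nat) (a b : \bar R) :
  (limn_esup u <= a -> a < b -> \forall n \near \oo, u n <= b)%E.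
Proof.
move=> ua ab; have := le_lt_trans ua ab.
(* The limit superior is an infimum of suprema over the sets of the filter, so one of these suprema
   is below b. *)
rewrite /limn_esup limf_esupE => /ereal_inf_lt[_ [V VF <-]] /ltW Vb.
apply: filterS VF => n Vn; apply: le_trans Vb.
by apply: ereal_sup_ubound; exists n.
Qed.

Section threshold.
Variables (R : realType) (d : nat).
Local Notation point := (d.+1.-tuple R).
Local Notation sigma := (@sphere_measure R d).
Local Notation U := (@unit_sphere R d.+1).
Implicit Types (x y e : point).

(** Cauchy-Schwarz for a unit vector e: the component of y orthogonal to e has nonnegative square
    norm. *)
Lemma dotp_sqr_le e y : U e -> dotp e y ^+ 2 <= dotp y y.
Proof.
move=> /dotp_unit e1.
have := dotp_ge0 (tuple_add y (tuple_scale (- dotp e y) e)).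
rewrite dotp_add dotp_scale ![dotp (tuple_add _ _) _]dotpC !dotp_add !dotp_scale
  e1 [dotp y e]dotpC.
by move=> h; rewrite -subr_ge0; lra.
Qed.

(** The hypothesis says |x - y| < r, as |x - y|^2 = 2 - 2 <x, y>; Cauchy-Schwarz applies to <e, y -
    x>. Small caps centred in a half-space thus stay in a slightly larger one. *)
Lemma dotp_lipschitz e x y r : U e -> U x -> U y -> 0 < r ->
  1 - r ^+ 2 / 2 < dotp x y -> dotp e y - r <= dotp e x.
Proof.
move=> e1 x1 y1 r0 xy; rewrite leNgt; apply/negP => h.
have := dotp_sqr_le (tuple_add y (tuple_opp x)) e1.
rewrite !dotp_add !dotp_opp ![dotp (tuple_add _ _) _]dotpC !dotp_add !dotp_opp.
rewrite !dotp_unit// [dotp y x]dotpC.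
by nra.
Qed.

Lemma cap_radius_pow (t : R) N : (0 < d)%N -> 0 < t -> (0 < N)%N ->
  (t * N%:R `^ (- d%:R^-1)) ^+ d = t ^+ d / N%:R.
Proof.
move=> d0 t0 N0; rewrite exprMn -[in X in _ * X]powR_mulrn ?powR_ge0//.
by rewrite -powRrM mulNr mulVf ?pnatr_eq0 -?lt0n// powR_inv1.
Qed.

Lemma cap_radius_small (t r : R) : (0 < d)%N -> 0 < t -> 0 < r ->
  \forall N \near \oo, 0 < t * N%:R `^ (- d%:R^-1) < r.
Proof.
move=> d0 t0 r0; near=> N.
have N0 : (0 < N)%N by near: N; exact: nbhs_infty_gt.
have p0 : 0 < t * N%:R `^ (- d%:R^-1) by rewrite mulr_gt0// powR_gt0// ltr0n.
rewrite p0/= -(@ltr_pXn2r _ d)// ?nnegrE ?ltW//.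
rewrite cap_radius_pow// ltr_pdivrMr ?ltr0n// mulrC -ltr_pdivrMr ?exprn_gt0//.
by near: N; exact: nbhs_infty_gtr.
Unshelve. all: by end_near. Qed.

(** Continuity from above along the half-spaces at height c - 1/(n+1), which decrease to the closed
    one. *)
Lemma sphere_measure_outer x (c eps : R) : 0 < eps ->
  exists2 r, 0 < r & (sigma (dotp x @^-1` `[(c - r)%R, +oo[) <=
    (fine (sigma (dotp x @^-1` `[c, +oo[)) + eps)%:E)%E.
Proof.
move=> eps0; pose F n := dotp x @^-1` `[c - n.+1%:R^-1, +oo[.
have mF n : measurable (F n) by exact: measurable_dotp_preimage.
have FE : \bigcap_n F n = dotp x @^-1` `[c, +oo[.
  apply/seteqP; split => y /=.
    move=> h; rewrite in_itv/= andbT leNgt; apply/negP => yc.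
    have cy : 0 < c - dotp x y by rewrite subr_gt0.
    have [n _ hn] := near_infty_natSinv_lt (PosNum cy).
    have := h n I; rewrite /F/= in_itv/= andbT; have := hn n (leqnn _) => /=.
    by move: (_^-1) => v; lra.
  rewrite in_itv/= andbT => cy n _; rewrite /F/= in_itv/= andbT.
  by rewrite (le_trans _ cy)// gerBl invr_ge0.
have : sigma \o F @ \oo --> sigma (\bigcap_n F n).
  apply: nonincreasing_cvg_mu => //.
  - by rewrite (le_lt_trans (probability_le1 _ _))// ltry.
  - by apply: bigcapT_measurable.
  move=> m n mn; apply/subsetPset => y; rewrite /F/= !in_itv/= !andbT.
  by apply: le_trans; rewrite lerB// lef_pV2 ?posrE// ler_nat ltnS.
rewrite FE => h.
have fin : sigma (dotp x @^-1` `[c, +oo[) \is a fin_num.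
  by rewrite fin_num_measure//; exact: measurable_dotp_preimage.
rewrite -(fineK fin) in h.
have /fine_cvgP[ff /cvgrPdist_le/(_ _ eps0) hh] := h.
near \oo => n.
exists n.+1%:R^-1; first by rewrite invr_gt0.
rewrite -/(F n) -[leLHS]fineK ?fin_num_measure// lee_fin.
have : `|fine (sigma (dotp x @^-1` `[c, +oo[)) - fine (sigma (F n))| <= eps
  by near: n; exact: hh.
by rewrite ler_norml => /andP[h1 _]; rewrite -lerBlDl -lerN2 opprB.
Unshelve. all: by end_near. Qed.

Lemma count_limsup (X : nat -> {fset point}) x (c eps : R) : (0 < d)%N ->
  (forall N, [set` X N] `<=` U) -> (forall N, #|` X N| = N) ->
  hyperuniform_threshold X -> U x -> 0 < eps ->
  \forall N \near \oo,
    (count_in (X N) (dotp x @^-1` `[c, +oo[))%:R <=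
      N%:R * (fine (sigma (dotp x @^-1` `[c, +oo[)) + eps).
Proof.
move=> d0 XU cardX [C hC] x1 eps0.
(* One third each for the enlargement of K, the variance term and the additive constant k = eta M of
   AM-GM. *)
pose eta := eps / 3; have eta0 : 0 < eta by rewrite divr_gt0.
have [r r0 hr] := @sphere_measure_outer x c eta eta0.
have [k k0 hk] := @sphere_measure_cap_ge R d.
have cc : \forall p \near (0 : R), 1 - r ^+ 2 / 2 < cos p.
  have /cvgr_gt : cos p @[p --> (0 : R)] --> (1 : R)
    by rewrite -(@cos0 R); exact: continuous_cos.
  by apply; rewrite gtrBl divr_gt0// exprn_gt0.
have /nbhs_ballP[q /= q0 hq] := cc.
(* A t^(d-1) dominates C t^(d-1) + 1 for t >= 1, whatever the sign of C. *)
pose A : R := `|C| + 1; have A0 : 0 < A by rewrite ltr_wpDl.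
(* [t] is fixed before [N], depending only on C, eta and k. *)
near (pinfty_nbhs R) => t.
have t1 : 1 <= t by near: t; exact: (nbhs_pinfty_ge (num_real _)).
have t0 : 0 < t by lra.
have tA : A <= t * (eta * k) ^+ 2.
  have : A / (eta * k) ^+ 2 <= t
    by near: t; exact: (nbhs_pinfty_ge (num_real _)).
  by rewrite ler_pdivrMr// exprn_gt0// mulr_gt0.
have ht : (limn_esup (fun N => number_variance (X N) (t * N%:R `^ (- d%:R^-1)))
       <= (C * t ^+ d.-1)%:E)%E by near: t.
(* The slack 1 turns the bound on the limit superior into a bound for all large [N]. *)
have Wlt : ((C * t ^+ d.-1)%:E < (C * t ^+ d.-1 + 1)%:E)%E
  by rewrite lte_fin ltrDl.
have hV := limn_esup_lt ht Wlt.
(* Radii below 1 allow the lower bound on caps; radii below q keep each cap within distance r of its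
   centre. *)
have m0 : 0 < Num.min 1 q by rewrite lt_min ltr01 q0.
near=> N.
have N0 : (0 < N)%N by near: N; exact: nbhs_infty_gt.
have pr : 0 < t * N%:R `^ (- d%:R^-1) < Num.min 1 q.
  by near: N; exact: cap_radius_small.
have VW : (number_variance (X N) (t * N%:R `^ (- d%:R^-1)) <=
    (C * t ^+ d.-1 + 1)%:E)%E.
  by near: N.
set p := t * _ in pr VW.
have [p0 p1 pq] : [/\ 0 < p, p < 1 & p < q].
  by move: pr; rewrite lt_min => /and3P[].
have pc : 1 - r ^+ 2 / 2 < cos p.
  by apply: hq; rewrite /ball/= sub0r normrN gtr0_norm.
set K := dotp x @^-1` `[c, +oo[.
have mKp : measurable (dotp x @^-1` `[c - r, +oo[)
  by exact: measurable_dotp_preimage.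
have KKp z y : U z -> U y -> K y -> cap y p z -> (dotp x @^-1` `[c - r, +oo[) z.
  move=> z1 y1; rewrite /K/= !in_itv/= !andbT => cy [_ yz].
  have := dotp_lipschitz x1 z1 y1 r0;
    rewrite (dotpC z) => /(_ (lt_trans pc yz)); lra.
set s := fine (sigma (cap x p)).
have sk : k * p ^+ d <= s.
  rewrite -lee_fin fineK; first by apply: hk => //; rewrite p0 ltW.
  by rewrite fin_num_measure//; exact: measurable_cap.
have s0 : 0 < s by rewrite (lt_le_trans _ sk)// mulr_gt0// exprn_gt0.
have Nr0 : 0 < N%:R :> R by rewrite ltr0n.
set M := N%:R * s.
have M0 : 0 < M by rewrite mulr_gt0.
have Mt : k * t ^+ d <= M.
  rewrite (_ : k * t ^+ d = N%:R * (k * p ^+ d)) ?ler_pM2l//.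
  by rewrite cap_radius_pow//; field; rewrite gt_eqF.
have etaM0 : 0 < eta * M by rewrite mulr_gt0.
have ekt0 : 0 < eta * (k * t ^+ d) by rewrite mulr_gt0// mulr_gt0// exprn_gt0.
(* The chain is A t^(d-1) <= (eta k)^2 t^d <= (eta k t^d)^2 <= (eta M)^2; the first step is the
   choice of t. *)
have VM : C * t ^+ d.-1 + 1 <= (eta * M) ^+ 2.
  have td1 : 1 <= t ^+ d.-1 by rewrite exprn_ege1.
  have td : 1 <= t ^+ d by rewrite exprn_ege1.
  apply: (@le_trans _ _ (A * t ^+ d.-1)).
    by rewrite mulrDl mul1r lerD// ler_wpM2r ?ler_norm// exprn_ge0// ltW.
  apply: (@le_trans _ _ ((eta * k) ^+ 2 * t ^+ d)).
    rewrite (_ : t ^+ d = t * t ^+ d.-1); last by rewrite -exprS prednK.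
    by rewrite mulrA (mulrC _ t) ler_wpM2r// exprn_ge0// ltW.
  apply: (@le_trans _ _ ((eta * (k * t ^+ d)) ^+ 2)).
    rewrite mulrA [leRHS]exprMn ler_wpM2l ?sqr_ge0//.
    by rewrite expr2 ler_peMr// (le_trans _ td).
  by rewrite ler_pXn2r ?nnegrE ?(ltW ekt0) ?(ltW etaM0)// ler_pM2l.
have := count_le_variance (XU N) x1 etaM0 mKp KKp.
rewrite /= cardX -/s -/M => h.
have : (((count_in (X N) K)%:R * s)%:E <= (M * (fine (sigma K) + eta))%:E +
  (((eta * M)^-1 * (eta * M) ^+ 2)%:E + (eta * M)%:E))%E.
  apply: (le_trans h); rewrite leeD// ?leeD2r//.
    by rewrite [leRHS]EFinM lee_wpmul2l// lee_fin ltW.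
  rewrite [leRHS]EFinM lee_wpmul2l//; first by rewrite lee_fin invr_ge0 ltW.
  by rewrite (le_trans VW).
rewrite -!EFinD lee_fin expr2 mulKf ?gt_eqF// => h2.
rewrite -(ler_pM2r s0) (le_trans h2)//.
rewrite (_ : _ * s = M * (fine (sigma K) + eps)); last by rewrite /M; ring.
by rewrite /eta le_eqVlt; apply/orP; left; apply/eqP; field.
Unshelve. all: by end_near. Qed.

End threshold.

(** * Two-sided bound for the density in a cap *)

Theorem theorem3 (R : realType) (d : nat) (hd : (1 <= d)%N)
    (X : nat -> {fset (d.+1.-tuple R)})
    (X_sphere : forall N : nat, [set` X N] `<=` @unit_sphere R d.+1)
    (card_X : forall N : nat, #|` X N| = N)
    (X_hyperuniform : hyperuniform_threshold X) :
  uniformly_distributed X.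
Proof.
move=> x phi x1 _; set a := fine _.
pose c := cos phi; pose K := dotp x @^-1` `[c, +oo[.
(* The complement of the open half-space is a closed half-space about the antipode, so the same
   upper bound serves for both. *)
pose K' := dotp (tuple_opp x) @^-1` `[- c, +oo[.
have nx1 : unit_sphere (tuple_opp x).
  by rewrite /unit_sphere/= /enorm dotp_opp dotpC dotp_opp opprK dotp_unit//
    sqrtr1.
have mcap := measurable_cap x phi.
have mpre D : measurable D -> measurable (dotp x @^-1` D)
  by exact: measurable_dotp_preimage.
have aE : sphere_measure (dotp x @^-1` `]c, +oo[) = a%:E.
  by rewrite -sphere_measure_cap fineK// fin_num_measure.
have KE : fine (sphere_measure K) = a.
  have -> : K = dotp x @^-1` `]c, +oo[ `|` [set y | dotp x y = c].
    apply/seteqP; split => y; rewrite /K/= !in_itv/= !andbT.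
      by rewrite le_eqVlt => /predU1P[->|]; [right|left].
    by move=> [/ltW//|->].
  have mpos : measurable (dotp x @^-1` `]c, +oo[) by exact: mpre.
  have mlevel : measurable [set y | dotp x y = c] by exact: (mpre [set c]).
  by rewrite (measureU0 mpos mlevel (sphere_measure_level c hd x1));
    exact: (congr1 fine aE).
have K'C : K' = ~` (dotp x @^-1` `]c, +oo[).
  apply/seteqP; split => y;
    rewrite /K'/= !in_itv/= !andbT (dotpC (tuple_opp x)) dotp_opp (dotpC y)
    lerN2.
    by rewrite leNgt => /negP.
  by rewrite leNgt => /negP.
have K'E : fine (sphere_measure K') = 1 - a.
  rewrite K'C probability_setC; last exact: mpre.
  by rewrite [X in fine (1 - X)%E]aE.
have cntK N : (cap_count (X N) x phi)%:R <= (count_in (X N) K)%:R :> R.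
  rewrite -[cap_count _ _ _]/(count_in _ (cap x phi)) !count_inE.
  apply: ler_sum => y _.
  rewrite !indicE ler_nat; have [|//] := boolP (y \in cap _ _).
  by rewrite inE => -[_ /ltW cy]; rewrite mem_set//= /K/= in_itv/= andbT.
(* Points of [X N] lie on the sphere, so each is either in the cap or in K'. *)
have cntK' N : (count_in (X N) K')%:R = N%:R - (cap_count (X N) x phi)%:R :> R.
  apply/eqP; rewrite eq_sym subr_eq -[cap_count _ _ _]/(count_in _ (cap x phi)).
  rewrite !count_inE -big_split/= -{1}(card_X N) card_fset_sum1 natr_sum
    !big_seq.
  apply/eqP; apply: eq_bigr => y yX; rewrite !indicE K'C in_setC.
  suff -> : (y \in cap x phi) = (y \in dotp x @^-1` `]c, +oo[)
    by case: (_ \in _); rewrite ?add0r ?addr0.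
  rewrite cap_dotp in_setI [y \in unit_sphere (n:=d.+1)]mem_set//.
  exact: X_sphere yX.
apply/cvgrPdist_le => e e0; near=> N.
have N0 : 0 < N%:R :> R by rewrite ltr0n; near: N; exact: nbhs_infty_gt.
have h1 : (count_in (X N) K)%:R <= N%:R * (fine (sphere_measure K) + e).
  by near: N; exact: count_limsup.
have h2 : (count_in (X N) K')%:R <= N%:R * (fine (sphere_measure K') + e).
  by near: N; exact: count_limsup.
(* The bound for K gives the upper estimate a + e; the one for K', of measure 1 - a, gives the lower
   estimate a - e. *)
rewrite KE in h1; rewrite K'E cntK' in h2.
have := cntK N => h3.
rewrite ler_distlC; apply/andP; split.
  by rewrite ler_pdivlMr//; nra.
by rewrite ler_pdivrMr//; nra.
Unshelve. all: by end_near. Qed.
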